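(* Let $G$ be a group acting by automorphisms on a rooted tree $T$ with no leaves. Then the boundary $\partial T$ decomposes as a disjoint union $$\partial T=\bigsqcup_{T'\prec T}\partial T',$$ where the union is over all minimal subtrees $T'$ of $T$ (with respect to the action of $G$). Moreover, there is a bijection between the set of minimal subtrees of $T$ and the boundary $\partial T_G$ of the orbit tree $T_G$ associated with the action of $G$ on $T$.
   Context: A rooted tree is a tree with a distinguished vertex (root); its $n$-th level is the set of vertices at distance $n$ from the root. The boundary $\partial T$ is the set of all infinite non-backtracking paths in $T$ starting at the root. A rooted tree (or subtree containing the root) has no leaves if each of its vertices lies on some infinite path of its boundary. Automorphisms preserve the root. A subtree of $T$ with no leaves is called rooted if it contains the root of $T$. A nonempty rooted subtree $T'$ of $T$ with no leaves is called minimal (denoted $T'\prec T$) if it is minimal with respect to inclusion among the $G$-invariant rooted subtrees of $T$ with no leaves. The boundary $\partial T'$ is regarded as a subset of $\partial T$. The orbit tree $T_G$ is the graph whose vertices are the orbits of $G$ on the levels of $T$, two orbits being adjacent iff they contain vertices that are adjacent in $T$; it is a rooted tree whose root is the one-element orbit of the root of $T$. *)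

(* Defs.v *)
From mathcomp Require Import all_boot.
From mathcomp Require Import boolp classical_sets functions.
Set Implicit Arguments.
Unset Strict Implicit.
Unset Printing Implicit Defensive.
Local Open Scope classical_set_scope.

(* A graph with vertices drawn from an ambient type V.  Keeping the vertex set
   as a field lets trees, their subtrees and orbit trees share one type.
   Edges may only join actual vertices, so that two graphs are equal iff they
   have the same vertices and the same edges.  Loops are excluded in
   [is_tree]. *)
Record graph (V : eqType) := Graph {
  verts : set V;
  edge : rel V;
  edge_sym : symmetric edge;
  edge_verts : forall x y, edge x y -> verts x
}.

Section Trees.
Variable V : eqType.
Implicit Types (T S : graph V) (r x y : V) (n : nat).

Definition connected_graph T :=
  forall x y, verts T x -> verts T y ->
    exists2 s : seq V, path (edge T) x s & last x s = y.

Definition acyclic_graph T :=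
  forall s : seq V, (2 < size s)%N -> ~ ucycle (edge T) s.

Definition is_tree T :=
  [/\ irreflexive (edge T), connected_graph T & acyclic_graph T].

Definition rooted_tree T r := is_tree T /\ verts T r.

Definition walk_of_length T x y n :=
  exists s : seq V, [/\ path (edge T) x s, last x s = y & size s = n].

Definition at_distance T x y n :=
  walk_of_length T x y n /\ forall m, walk_of_length T x y m -> (n <= m)%N.

Definition level T r n : set V := [set x | verts T x /\ at_distance T r x n].

Definition boundary T r : set (nat -> V) :=
  [set p | [/\ p 0 = r,
               forall n, edge T (p n) (p n.+1) &
               forall n, p n.+2 <> p n]].

Definition no_leaves T r :=
  forall x, verts T x -> exists2 p, boundary T r p & exists n, p n = x.

Definition subgraph S T :=
  verts S `<=` verts T /\ (forall x y, edge S x y -> edge T x y).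

Definition subtree S T := is_tree S /\ subgraph S T.

End Trees.

Section Actions.
Variables (G : groupType) (V : eqType).
Implicit Types (T S : graph V) (r x y : V) (act : G -> V -> V).

(* A left action by root-preserving automorphisms.  Only the values of [act]
   on the vertices of T matter. *)
Definition acts_on_rooted_tree T r act :=
  [/\ (forall x, verts T x -> act 1%g x = x),
      (forall g h x, verts T x -> act (g * h)%g x = act g (act h x)),
      (forall g x, verts T x -> verts T (act g x)),
      (forall g x y, verts T x -> verts T y ->
         edge T (act g x) (act g y) = edge T x y) &
      (forall g, act g r = r)].

Definition invariant act S :=
  (forall g x, verts S x -> verts S (act g x)) /\
  (forall g x y, edge S x y -> edge S (act g x) (act g y)).

(* G-invariant subtrees with no leaves that contain the root r (in particular,
   nonempty). *)
Definition invariant_rooted_subtree T r act S :=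
  [/\ subtree S T, verts S r, no_leaves S r & invariant act S].

Definition minimal_subtree T r act : set (graph V) :=
  [set S | invariant_rooted_subtree T r act S /\
     forall S', invariant_rooted_subtree T r act S' -> subgraph S' S -> S' = S].

Definition act_orbit act x : set V := [set act g x | g in [set: G]].

Definition orbit_verts T r act : set (set V) :=
  [set O | exists n x, level T r n x /\ O = act_orbit act x].

Definition orbit_edge T r act : rel (set V) := fun A B =>
  `[< [/\ orbit_verts T r act A, orbit_verts T r act B &
          exists x y, [/\ A x, B y & edge T x y]] >].

Lemma orbit_edge_sym T r act : symmetric (orbit_edge T r act).
Proof.
move=> A B; apply/asboolP/asboolP => -[vA vB [x [y [Ax By exy]]]];
  by split=> //; exists y, x; split=> //; rewrite edge_sym.
Qed.

Lemma orbit_edge_verts T r act A B :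
  orbit_edge T r act A B -> orbit_verts T r act A.
Proof. by move=> /asboolP[]. Qed.

(* The orbit tree T_G; its root is [act_orbit act r]. *)
Definition orbit_tree T r act : graph (set V) :=
  Graph (@orbit_edge_sym T r act) (@orbit_edge_verts T r act).

End Actions.

(* Main.v *)
Require Import Defs.
From mathcomp Require Import all_boot.
From mathcomp Require Import boolp classical_sets functions.

(* A path p in the boundary generates the subtree spanned by the G-translates
   of its vertices.  As the action preserves levels and every vertex has a
   unique parent, this is the least invariant subtree having p as a boundary
   path, and its boundary paths q are those with q n in the orbit of p n for all
   n; each such q generates the same subtree.  So the minimal subtrees are
   exactly these, any of their boundary paths determines them, and they are
   encoded by the sequences of orbits of p n.  Conversely, a boundary path of
   the orbit tree goes down one level at each step, since the orbit of a vertex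
   has a unique parent, and it lifts to T one edge at a time. *)

Set Implicit Arguments.
Unset Strict Implicit.
Unset Printing Implicit Defensive.
Local Open Scope classical_set_scope.

(** * Simple paths in acyclic graphs *)

Section Graphs.
Variable V : eqType.
Implicit Types (T S : graph V) (r x y z : V) (s t : seq V) (n : nat).

Lemma graph_eq T S : verts T = verts S -> edge T = edge S -> T = S.
Proof.
case: T S => [v e es ev] [v' e' es' ev'] /= vE eE; subst v' e'.
by congr Graph; exact: Prop_irrelevance.
Qed.

Lemma edge_verts_r T x y : edge T x y -> verts T y.
Proof. by rewrite edge_sym => /edge_verts. Qed.

Lemma path_rev T x s :
  path (edge T) (last x s) (rev (belast x s)) = path (edge T) x s.
Proof. by rewrite rev_path; apply: eq_path => y z; rewrite edge_sym. Qed.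

(* If the first steps of [s] and [t] differ, the part of [s] up to its first
   vertex on [t], closed up by the initial part of [t] leading to that vertex,
   is a cycle. *)
Lemma acyclic_path_uniq T : acyclic_graph T -> forall x s t,
  path (edge T) x s -> path (edge T) x t -> uniq (x :: s) -> uniq (x :: t) ->
  last x s = last x t -> s = t.
Proof.
move=> acT x s; elim: s x => [|a s IHs] x t.
  case: t => //= b t _ _ _ /andP[xt _] xE.
  by rewrite xE mem_last in xt.
case: t => [|b t] ps pt us ut lE.
  by case/andP: us; rewrite -{1}[x]lE /= mem_last.
have [ab|ab] := eqVneq a b.
  move: pt ut lE; rewrite -ab => pt ut lE; congr (_ :: _).
  move: ps pt us ut => /= /andP[_ ps] /andP[_ pt] /andP[_ us] /andP[_ ut].
  exact: (IHs a).
exfalso.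
have : has (mem (b :: t)) (a :: s).
  apply/hasP; exists (last a s); first exact: mem_last.
  by have /= -> := lE; apply: mem_last b t.
move def_s : (a :: s) ps us {lE} => s0 ps us hs.
move def_t : (b :: t) pt ut hs => t0 pt ut hs.
move: ps us def_s; case/split_find: hs => c s1 s2 ct s1t ps us def_s.
move: pt ut def_t s1t; case/splitPr: ct => t1 t2 pt ut def_t s1t.
apply: (acT (x :: s1 ++ c :: rev t1)).
  (* The cycle has at least three vertices: if [s1] and [t1] were both empty, then [a] and [b] would
     both be [c]. *)
  rewrite /= size_cat /= size_rev addnS ltnS ltnS.
  case: s1 def_s {ps us s1t} => //; case: t1 def_t {pt ut} => //.
  by move=> [bc _] [ac _]; rewrite ac bc eqxx in ab.
apply/andP; split.
  move: ps pt; rewrite !cat_path rcons_path /= => /andP[/andP[ps1 es1] _].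
  move=> /and3P[pt1 et1 _].
  rewrite rcons_cat cat_path /= ps1 es1 /=.
  rewrite -rev_cons -(belast_rcons x t1 c) -[X in path _ X _](last_rcons x t1 c).
  by rewrite path_rev rcons_path pt1.
move: us ut; rewrite /= cat_rcons !mem_cat !cat_uniq !inE /= !negb_or.
move=> /andP[/and3P[xs1 xc _] /and3P[us1 /andP[cs1 _] _]].
move=> /andP[/and3P[xt1 _ _] /and3P[ut1 /andP[ct1 _] _]].
rewrite mem_rev rev_uniq xs1 xc xt1 us1 ut1 /=.
rewrite [c \in s1](negPf cs1) mem_rev [c \in t1](negPf ct1) /= andbT.
apply: contra s1t => /hasP[y yt1 ys1]; apply/hasP; exists y => //.
by have : y \in t1 ++ c :: t2 by rewrite mem_cat -mem_rev yt1.
Qed.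

(** A simple path from the root, listed without its start, so that in a tree its size is the level
    of its end. *)
Definition branch T r s := path (edge T) r s && uniq (r :: s).

(** * Branches, levels and parents in a rooted tree *)

Section RootedTree.
Variables (T : graph V) (r : V).
Hypothesis treeT : rooted_tree T r.

Let irrT : irreflexive (edge T). Proof. by case: treeT => -[]. Qed.

Lemma branch_exists x : verts T x -> exists2 s, branch T r s & last r s = x.
Proof.
case: treeT => -[_ /(_ r x) conT _] rT vx; have [//|//|s ps <-] := conT.
by case/shortenP: ps => s' ps' us' _; exists s' => //; apply/andP.
Qed.

Lemma branch_inj s t : branch T r s -> branch T r t ->
  last r s = last r t -> s = t.
Proof.
case: treeT => -[_ _ acT] _ /andP[ps us] /andP[pt ut].
exact: (acyclic_path_uniq acT ps pt us ut).
Qed.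

(** A walk shortens to a simple path that is no longer, and the simple path from [r] to [x] is
    unique, so its size is the distance. *)
Lemma levelP n x :
  level T r n x <-> exists s, [/\ branch T r s, last r s = x & size s = n].
Proof.
have short m y : walk_of_length T r y m -> exists s,
    [/\ branch T r s, last r s = y & (size s <= m)%N].
  move=> [s [ps <- <-]]; case/shortenP: ps => s' ps' us' ss'.
  by exists s'; split; [apply/andP | | apply: uniq_leq_size => //; case/andP: us'].
split=> [[vx [wn minn]]|[s [bs <- <-]]].
  have [s [bs lsx sn]] := short _ _ wn; exists s; split=> //.
  apply/eqP; rewrite eqn_leq sn minn //.
  by exists s; split=> //; case/andP: bs.
have /andP[ps _] := bs; split.
  case: treeT => _ rT; case: (lastP s) ps => //= s' y.
  rewrite rcons_path last_rcons => /andP[_].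
  exact: edge_verts_r.
split=> [|m /short[t [bt ltx tm]]]; first by exists s.
by rewrite -(branch_inj bt bs ltx).
Qed.

Lemma level_exists x : verts T x -> exists n, level T r n x.
Proof.
by move=> /branch_exists[s bs lsx]; exists (size s); apply/levelP; exists s.
Qed.

Lemma level_inj m n x : level T r m x -> level T r n x -> m = n.
Proof.
move=> /levelP[s [bs sx <-]] /levelP[t [bt tx <-]].
by rewrite (branch_inj bs bt) // sx.
Qed.

Lemma level_root : level T r 0 r.
Proof. by apply/levelP; exists [::]. Qed.

Lemma branch_prefix s t : branch T r s -> branch T r t ->
  last r t \in r :: s -> exists u, s = t ++ u.
Proof.
move=> /andP[ps us] bt; move def_y: (last r t) => y ys.
case/splitPl: ys ps us => s1 s2 s1y ps us; exists s2; congr (_ ++ _).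
apply: branch_inj => //; last by rewrite s1y.
move: ps us; rewrite /branch cat_path -cat_cons cat_uniq.
by move=> /andP[-> _] /andP[-> _].
Qed.

(** If the end of one branch is off the other, the edge extends that other branch to a simple path,
    which is then the first branch by uniqueness. *)
Lemma branch_edge s t : branch T r s -> branch T r t ->
  edge T (last r s) (last r t) ->
  t = rcons s (last r t) \/ s = rcons t (last r s).
Proof.
have step u v : branch T r u -> branch T r v -> edge T (last r u) (last r v) ->
    last r v \notin r :: u -> v = rcons u (last r v).
  move=> bu bv euv vu; apply: branch_inj => //; last by rewrite last_rcons.
  have /andP[pu uu] := bu.
  by rewrite /branch rcons_path pu euv -rcons_cons rcons_uniq vu uu.
move=> bs bt est.
have [ts|/(step _ _ bs bt est)] := boolP (last r t \in r :: s); last by left.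
have [st|/(step _ _ bt bs)] := boolP (last r s \in r :: t); last first.
  by rewrite edge_sym => /(_ est); right.
(* Each branch is now a prefix of the other, so they coincide and the edge is a loop. *)
have [u sE] := branch_prefix bs bt ts; have [v tE] := branch_prefix bt bs st.
move: (congr1 size sE) (congr1 size tE); rewrite !size_cat => sz1 sz2.
have u0 : u = [::].
  apply: size0nil; apply/eqP; rewrite -leqn0 -(leq_add2l (size t)) addn0 -sz1 sz2.
  by rewrite leq_addr.
by move: est; rewrite sE u0 cats0 irrT.
Qed.

Lemma level_edge n x y : level T r n x -> edge T x y ->
  level T r n.+1 y \/ exists2 m, n = m.+1 & level T r m y.
Proof.
move=> /levelP[s [bs sx <-]] exy.
have [t bt ty] := branch_exists (edge_verts_r exy).
have := branch_edge bs bt; rewrite sx ty => /(_ exy)[E|E].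
  by left; apply/levelP; exists t; split=> //; rewrite E size_rcons.
right; exists (size t); first by rewrite E size_rcons.
by apply/levelP; exists t.
Qed.

(** The branch to [z] is the branch to [x], and also the branch to [y], extended by [z]. *)
Lemma parent_uniq n x y z : level T r n x -> level T r n y ->
  level T r n.+1 z -> edge T x z -> edge T y z -> x = y.
Proof.
move=> /levelP[s [bs <- sn]] /levelP[t [bt <- tn]] /levelP[u [bu <- un]].
have no v : size v = n -> v <> rcons u (last r v).
  move=> vn /(congr1 size); rewrite size_rcons vn un => nE.
  by have := leqnSn n.+1; rewrite -nE ltnn.
move=> /(branch_edge bs bu)[E|/(no _ sn)//] /(branch_edge bt bu)[E'|/(no _ tn)//].
by congr last; apply: (@rcons_injl _ (last r u)); rewrite -E -E'.
Qed.

(** Turns non-backtracking into descending: a first step upwards would lead to the unique parent,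
    which is the vertex just left. *)
Lemma boundary_levelP p : boundary T r p <->
  [/\ p 0 = r, forall n, edge T (p n) (p n.+1) & forall n, level T r n (p n)].
Proof.
split=> -[p0 pe pb]; split=> // n; last first.
  move=> E; have := pb n.+2; rewrite E => /level_inj/(_ (pb n)) nE.
  by have := leqnSn n.+1; rewrite nE ltnn.
(* Excluding a step upwards takes the levels of two consecutive vertices. *)
suff: level T r n (p n) /\ level T r n.+1 (p n.+1) by case.
elim: n => [|n [IH1 IH2]].
  rewrite p0; split; first exact: level_root.
  have e01 : edge T r (p 1) by rewrite -{1}p0.
  by have [|[]] := level_edge level_root e01.
split=> //; have [//|[_ [<-] IH3]] := level_edge IH2 (pe n.+1).
by case: (pb n); apply: (parent_uniq IH3 IH1 IH2) => //; rewrite edge_sym.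
Qed.

Lemma boundary_level p n : boundary T r p -> level T r n (p n).
Proof. by move=> /boundary_levelP[]. Qed.

End RootedTree.

(** * Connectedness, subgraphs and induced subgraphs *)

Lemma path_to_root T r s : path (edge T) r s ->
  exists2 t, path (edge T) (last r s) t & last (last r s) t = r.
Proof.
move=> ps; exists (rev (belast r s)); first by rewrite path_rev.
by case: s {ps} => //= a s; rewrite rev_cons last_rcons.
Qed.

Lemma connected_from_root T r :
  (forall x, verts T x -> exists2 s, path (edge T) r s & last r s = x) ->
  connected_graph T.
Proof.
move=> reach x y /reach[s ps <-] /reach[t pt <-].
have [u pu lu] := path_to_root ps.
by exists (u ++ t); rewrite ?cat_path ?last_cat lu // pu.
Qed.

Lemma path_along T (p : nat -> V) : (forall n, edge T (p n) (p n.+1)) ->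
  forall n, exists2 s, path (edge T) (p 0) s & last (p 0) s = p n.
Proof.
move=> pe; elim=> [|n [s ps ls]]; first by exists [::].
by exists (rcons s (p n.+1)); rewrite ?last_rcons // rcons_path ps ls pe.
Qed.

Lemma sub_boundary S T r : subgraph S T -> boundary S r `<=` boundary T r.
Proof. by move=> [_ ST] p [p0 pe pb]; split=> // n; apply: ST. Qed.

Lemma sub_acyclic S T : subgraph S T -> acyclic_graph T -> acyclic_graph S.
Proof.
move=> [_ ST] acT [//|x s] sz /andP[cs us]; apply: (acT (x :: s)) => //.
by apply/andP; split=> //; apply: sub_path cs.
Qed.

Lemma sub_irreflexive S T : subgraph S T ->
  irreflexive (edge T) -> irreflexive (edge S).
Proof. by move=> [_ ST] irrT x; apply/negP => /ST; rewrite irrT. Qed.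

Lemma subgraph_antisym S T : subgraph S T -> subgraph T S -> S = T.
Proof.
move=> [vST eST] [vTS eTS]; apply: graph_eq; first by apply/seteqP.
by apply/funext => x; apply/funext => y; apply/idP/idP => [/eST|/eTS].
Qed.

Section Induced.
Variables (T : graph V) (A : set V).

Definition induced_edge : rel V :=
  fun x y => [&& edge T x y, `[< A x >] & `[< A y >]].

Lemma induced_edge_sym : symmetric induced_edge.
Proof. by move=> x y; rewrite /induced_edge edge_sym [X in _ && X]andbC. Qed.

Lemma induced_edge_verts x y : induced_edge x y -> A x.
Proof. by case/and3P => _ /asboolP. Qed.

Definition induced := Graph induced_edge_sym induced_edge_verts.

Lemma induced_edgeP x y :
  reflect [/\ edge T x y, A x & A y] (edge induced x y).
Proof. by apply: (iffP and3P) => -[? /asboolP ? /asboolP ?]. Qed.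

Lemma induced_sub : A `<=` verts T -> subgraph induced T.
Proof. by move=> AT; split=> // x y /induced_edgeP[]. Qed.

End Induced.
End Graphs.

(** * The action on levels, boundary paths and orbits *)

Section Action.
Variables (G : groupType) (V : eqType) (T : graph V) (r : V).
Variable act : G -> V -> V.
Hypothesis treeT : rooted_tree T r.
Hypothesis actT : acts_on_rooted_tree T r act.
Implicit Types (S : graph V) (g h : G) (x y : V) (p q : nat -> V).

Let act1 x : verts T x -> act 1%g x = x. Proof. by case: actT => + *; apply. Qed.
Let actM g h x : verts T x -> act (g * h)%g x = act g (act h x).
Proof. by case: actT => _ + *; apply. Qed.
Let act_verts g x : verts T x -> verts T (act g x).
Proof. by case: actT => _ _ + *; apply. Qed.
Let act_edge g x y : edge T x y -> edge T (act g x) (act g y).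
Proof.
case: actT => _ _ _ eE _ exy.
by rewrite eE //; [apply: edge_verts exy | apply: edge_verts_r exy].
Qed.
Let act_root g : act g r = r. Proof. by case: actT. Qed.

Lemma level_verts n x : level T r n x -> verts T x. Proof. by case. Qed.

Lemma actK g x : verts T x -> act g^-1%g (act g x) = x.
Proof. by move=> vx; rewrite -actM // mulVg act1. Qed.

(** The root is fixed, so walks from it are carried to walks of the same length; applying the
    inverse keeps the length minimal. *)
Lemma act_level g n x : level T r n x -> level T r n (act g x).
Proof.
have act_walk h m y :
    walk_of_length T r y m -> walk_of_length T r (act h y) m.
  move=> [s [ps <- <-]]; exists (map (act h) s); split.
  - by rewrite -(act_root h); apply: (homo_path (@act_edge h)).
  - by rewrite -{1}(act_root h) last_map.
  - by rewrite size_map.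
move=> [vx [wx minx]]; split; first exact: act_verts.
split=> [|m /(act_walk g^-1%g)]; first exact: act_walk.
by rewrite actK //; apply: minx.
Qed.

Lemma boundary_verts p n : boundary T r p -> verts T (p n).
Proof. by move=> /(boundary_level treeT)-/(_ n)/level_verts. Qed.

Lemma act_boundary g p : boundary T r p -> boundary T r (fun n => act g (p n)).
Proof.
move=> /(boundary_levelP treeT)[p0 pe pl]; apply/(boundary_levelP treeT).
by split=> [|n|n]; rewrite ?p0 //; [exact: act_edge | exact: act_level].
Qed.

Lemma orbit_act g x : act_orbit act x (act g x). Proof. by exists g. Qed.

Lemma orbit_refl x : verts T x -> act_orbit act x x.
Proof. by move=> vx; exists 1%g => //; rewrite act1. Qed.

Lemma orbit_eq x y : verts T x -> act_orbit act x y ->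
  act_orbit act y = act_orbit act x.
Proof.
move=> vx [g _ <-]; apply/seteqP; split=> z [h _ <-].
  by exists (h * g)%g => //; rewrite actM.
by exists (h * g^-1)%g => //; rewrite actM ?actK //; apply: act_verts.
Qed.

Lemma orbit_level n x y : level T r n x -> act_orbit act x y -> level T r n y.
Proof. by move=> lx [g _ <-]; apply: act_level. Qed.

(** * The subtree generated by a boundary path, and minimality *)

Definition orbit_subtree p : graph V :=
  induced T [set x | exists n, act_orbit act (p n) x].

Lemma orbit_subtree_sub p : boundary T r p -> subgraph (orbit_subtree p) T.
Proof.
by move=> bp; apply: induced_sub => x [n [g _ <-]]; apply/act_verts/boundary_verts.
Qed.

Lemma orbit_subtree_edge p g n : boundary T r p ->
  edge (orbit_subtree p) (act g (p n)) (act g (p n.+1)).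
Proof.
move=> [_ pe _]; apply/induced_edgeP.
by split; [exact: act_edge | exists n | exists n.+1]; try exact: orbit_act.
Qed.

Lemma orbit_subtree_act_boundary p g : boundary T r p ->
  boundary (orbit_subtree p) r (fun n => act g (p n)).
Proof.
move=> bp; have [gp0 _ gpb] := act_boundary g bp.
by split=> // n; apply: orbit_subtree_edge.
Qed.

Lemma orbit_subtree_self p : boundary T r p -> boundary (orbit_subtree p) r p.
Proof.
move=> bp; have {2}<- : (fun n => act 1%g (p n)) = p.
  by apply/funext => n; rewrite act1 //; apply: boundary_verts.
exact: orbit_subtree_act_boundary.
Qed.

(** The vertex lies in the orbit of some [p m], and [m] must be [n] because orbits stay within a
    level. *)
Lemma orbit_subtree_level p n x : boundary T r p ->
  level T r n x -> verts (orbit_subtree p) x -> act_orbit act (p n) x.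
Proof.
move=> bp lx [m pmx].
by rewrite (level_inj treeT lx (orbit_level (boundary_level treeT m bp) pmx)).
Qed.

Lemma orbit_subtree_boundary p q : boundary T r p ->
  boundary (orbit_subtree p) r q -> forall n, act_orbit act (p n) (q n).
Proof.
move=> bp bq n; apply: orbit_subtree_level => //.
  by apply: (boundary_level treeT); apply: sub_boundary bq; apply: orbit_subtree_sub.
by case: bq => _ /(_ n)/edge_verts.
Qed.

Lemma orbit_subtree_eq p q : boundary T r p ->
  (forall n, act_orbit act (p n) (q n)) -> orbit_subtree q = orbit_subtree p.
Proof.
move=> bp pq; have qE n := orbit_eq (boundary_verts n bp) (pq n).
by congr induced; apply/seteqP; split=> x [n xn]; exists n; rewrite ?qE // -qE.
Qed.

Lemma orbit_subtree_invariant p : boundary T r p ->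
  invariant_rooted_subtree T r act (orbit_subtree p).
Proof.
move=> bp; have sT := orbit_subtree_sub bp.
have [[irrT _ acT] rT] := treeT.
split.
- split=> //; split.
  + exact: sub_irreflexive irrT.
  (* Every vertex lies on a translate of [p], and all translates start at the fixed root; they also
     witness the absence of leaves below. *)
  + apply: (@connected_from_root _ _ r) => x [n [g _ <-]].
    have [gp0 gpe _] := orbit_subtree_act_boundary g bp.
    by have := path_along gpe n; rewrite gp0.
  + exact: sub_acyclic acT.
- by exists 0; have [-> _ _] := bp; apply: orbit_refl.
- move=> x [n [g _ <-]]; exists (fun n => act g (p n)); last by exists n.
  exact: orbit_subtree_act_boundary.
- have inv g x : verts (orbit_subtree p) x -> verts (orbit_subtree p) (act g x).
    move=> [n [h _ <-]]; exists n, (g * h)%g => //.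
    by rewrite actM //; apply: boundary_verts.
  split=> // g x y /induced_edgeP[exy vx vy]; apply/induced_edgeP.
  by split; [exact: act_edge | exact: inv | exact: inv].
Qed.

(* An edge between [act g (p n)] and [act h (p n.+1)] joins the latter to its
   unique parent [act h (p n)], so it is a translate of an edge of [p]. *)
Lemma orbit_subtree_least S p : subgraph S T -> Defs.invariant act S ->
  boundary S r p -> subgraph (orbit_subtree p) S.
Proof.
move=> ST [Sv Se] bpS; have bp := sub_boundary ST bpS; have [_ pe _] := bpS.
have down n x y : level T r n x -> level T r n.+1 y -> edge T x y ->
    verts (orbit_subtree p) y -> edge S x y.
  move=> lx ly exy /(orbit_subtree_level bp ly)[h _ hy]; rewrite -hy in ly exy *.
  suff -> : x = act h (p n) by apply: Se.
  apply: (parent_uniq treeT lx _ ly exy).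
    exact/act_level/boundary_level.
  by apply: act_edge; case: bp.
split=> [x [n [g _ <-]]|x y /induced_edgeP[exy vx vy]].
  exact/Sv/(edge_verts (pe n)).
have [n lx] := level_exists treeT (edge_verts exy).
have [ly|[m nE ly]] := level_edge treeT lx exy; first exact: (down n).
by rewrite edge_sym; apply: (down m) => //; rewrite -?nE // edge_sym.
Qed.

(** A smaller invariant subtree [S] has a boundary path [q]; it runs through the orbits of the
    [p n], so it generates the same subtree, which therefore lies in [S]. *)
Lemma minimal_orbit_subtree p : boundary T r p ->
  minimal_subtree T r act (orbit_subtree p).
Proof.
move=> bp; split=> [|S [[_ ST] rS leaflessS invS] Sp].
  exact: orbit_subtree_invariant.
have [q bqS _] := leaflessS _ rS.
apply: subgraph_antisym => //; rewrite -(orbit_subtree_eq bp (q := q)).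
  exact: orbit_subtree_least.
exact/orbit_subtree_boundary/(sub_boundary Sp).
Qed.

Lemma minimal_subtreeE S p : minimal_subtree T r act S -> boundary S r p ->
  S = orbit_subtree p.
Proof.
move=> [[[_ ST] rS leaflessS invS] minS] bpS; apply/esym/minS.
  exact/orbit_subtree_invariant/(sub_boundary ST).
exact: orbit_subtree_least.
Qed.

Lemma minimal_subtree_boundary S : minimal_subtree T r act S ->
  boundary S r !=set0 /\ boundary S r `<=` boundary T r.
Proof.
move=> [[[_ ST] rS leaflessS _] _]; split; last exact: sub_boundary.
by have [p ? _] := leaflessS _ rS; exists p.
Qed.

(** * Boundary paths of the orbit tree *)

Lemma orbit_tree_edge x y : edge T x y ->
  edge (orbit_tree T r act) (act_orbit act x) (act_orbit act y).
Proof.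
move=> exy; have vx := edge_verts exy; have vy := edge_verts_r exy.
have orbit_verts_orbit z : verts T z ->
    orbit_verts T r act (act_orbit act z).
  by move=> /(level_exists treeT)[n lz]; exists n, z.
apply/asboolP; split; [exact: orbit_verts_orbit.. |].
by exists x, y; split=> //; apply: orbit_refl.
Qed.

Lemma orbit_tree_boundary p : boundary T r p ->
  boundary (orbit_tree T r act) (act_orbit act r) (fun n => act_orbit act (p n)).
Proof.
move=> /[dup] bp [p0 pe _]; split=> [|n|n]; rewrite ?p0 //.
  exact: orbit_tree_edge.
(* Backtracking among orbits would place [p n.+2] on level [n]. *)
move=> E; have: act_orbit act (p n) (p n.+2).
  by rewrite -E; apply/orbit_refl/boundary_verts.
move=> /(orbit_level (boundary_level treeT n bp)).
move=> /(level_inj treeT (boundary_level treeT n.+2 bp)) nE.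
by have := leqnSn n.+1; rewrite nE ltnn.
Qed.

(** Unlike [orbit_verts], this records which level the orbit lies on. *)
Definition level_orbit n (O : set V) :=
  exists2 x, level T r n x & O = act_orbit act x.

Lemma level_orbit_mem n O x : level_orbit n O -> O x ->
  level T r n x /\ O = act_orbit act x.
Proof.
move=> [y ly ->] yx; split; first exact: orbit_level yx.
by rewrite (orbit_eq (level_verts ly) yx).
Qed.

(** The counterpart of [boundary_levelP] for orbits: translates of a vertex have translates of its
    parent as parents, so a step upwards would return to the previous orbit. *)
Lemma orbit_tree_boundary_level O :
  boundary (orbit_tree T r act) (act_orbit act r) O ->
  forall n, level_orbit n (O n).
Proof.
move=> [O0 Oe Ob] n.
have step m x y : level_orbit m (O m) -> O m x -> O m.+1 y ->
    level T r m.+1 y -> level_orbit m.+1 (O m.+1).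
  move=> lOm Omx Omy ly; exists y => //.
  have /asboolP[_ [k [z [lz zE]]] _] := Oe m.
  by rewrite zE in Omy *; rewrite (orbit_eq (level_verts lz) Omy).
suff: level_orbit n (O n) /\ level_orbit n.+1 (O n.+1) by case.
elim: n => [|n [IH1 IH2]].
  have l0 : level_orbit 0 (O 0) by exists r => //; apply: level_root.
  have /asboolP[_ _ [x [y [Ox Oy exy]]]] := Oe 0.
  have [lx _] := level_orbit_mem l0 Ox.
  by split=> //; have [ly|[//]] := level_edge treeT lx exy; apply: step Ox Oy ly.
split=> //; have /asboolP[_ [k [z [lz zE]]] [x [y [Ox Oy exy]]]] := Oe n.+1.
have [lx xE] := level_orbit_mem IH2 Ox.
have [ly|[_ [<-] ly]] := level_edge treeT lx exy; first exact: step Ox Oy ly.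
(* Here [y] is the parent of [x]. The edge from [O n] to [O n.+1] ends at a translate of [x], so it
   starts at the same translate of [y], whence [O n.+2] is [O n]. *)
have /asboolP[_ _ [a [b [Oa]]]] := Oe n.
rewrite xE => -[g _ <-] eab; case: (Ob n).
have [la ->] := level_orbit_mem IH1 Oa.
have -> : a = act g y.
  apply: (parent_uniq treeT la (act_level g ly) (act_level g lx) eab).
  by apply: act_edge; rewrite edge_sym.
rewrite zE in Oy *.
have vy := level_verts ly.
by rewrite (orbit_eq vy (orbit_act g y)) (orbit_eq (level_verts lz) Oy).
Qed.

(** Adjacency of orbits gives an edge at one representative only; translating it reaches any [x] in
    the orbit. *)
Lemma orbit_tree_child O n x : boundary (orbit_tree T r act) (act_orbit act r) O ->
  O n x -> exists2 y, O n.+1 y & edge T x y.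
Proof.
move=> bO Ox; have lO := orbit_tree_boundary_level bO.
have [_ /(_ n)/asboolP[_ _ [a [b [Oa Ob eab]]]] _] := bO.
have [la OnE] := level_orbit_mem (lO n) Oa.
have [lb OSnE] := level_orbit_mem (lO n.+1) Ob.
move: Ox; rewrite OnE OSnE => -[g _ <-].
by exists (act g b); [exact: orbit_act | exact: act_edge].
Qed.

Lemma orbit_tree_boundary_lift O :
  boundary (orbit_tree T r act) (act_orbit act r) O ->
  exists2 p, boundary T r p & forall n, O n = act_orbit act (p n).
Proof.
move=> bO; have lO := orbit_tree_boundary_level bO.
have /choice[child childP] : forall nx : nat * V, exists y,
    O nx.1 nx.2 -> O nx.1.+1 y /\ edge T nx.2 y.
  (* Outside [O n] the value [x] is a dummy. *)
  move=> [n x] /=; have [Ox|nOx] := pselect (O n x); last by exists x.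
  by have [y] := orbit_tree_child bO Ox; exists y.
pose p := nat_rect (fun=> V) r (fun n x => child (n, x)).
have Op n : O n (p n).
  elim: n => [|n IHn]; last by have [] := childP (n, p n) IHn.
  by have [-> _ _] := bO; apply: orbit_refl; case: treeT.
exists p => [|n]; last by have [] := level_orbit_mem (lO n) (Op n).
apply/(boundary_levelP treeT); split=> // n.
  by have [] := childP (n, p n) (Op n).
by have [] := level_orbit_mem (lO n) (Op n).
Qed.

(** Recovers the sequence of orbits from the subtree alone, without reference to the path that
    generates it. *)
Lemma orbit_subtree_level_set p : boundary T r p ->
  (fun n => verts (orbit_subtree p) `&` level T r n) =
  (fun n => act_orbit act (p n)).
Proof.
move=> bp; apply/funext => n; apply/seteqP; split=> x.
  by move=> [vx lx]; apply: orbit_subtree_level.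
move=> pnx; split; first by exists n.
exact: orbit_level (boundary_level treeT n bp) pnx.
Qed.

End Action.

(** * Decomposition of the boundary, and the bijection *)

Theorem proposition2p1 (G : groupType) (V : eqType) (T : graph V) (r : V)
    (act : G -> V -> V)
    (treeT : rooted_tree T r)
    (leaflessT : no_leaves T r)
    (actT : acts_on_rooted_tree T r act) :
  [/\ boundary T r = \bigcup_(T' in minimal_subtree T r act) boundary T' r,
      trivIset (minimal_subtree T r act) (fun T' => boundary T' r) &
      exists f : graph V -> (nat -> set V),
        set_bij (minimal_subtree T r act)
                (boundary (orbit_tree T r act) (act_orbit act r)) f].
Proof.
have minE S p := @minimal_subtreeE G V T r act treeT actT S p.
have minP p := @minimal_orbit_subtree G V T r act treeT actT p.
split.
- apply/seteqP; split=> [p bp|p [S minS bpS]].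
    by exists (orbit_subtree T act p); [exact: minP | exact: orbit_subtree_self].
  by have [_] := minimal_subtree_boundary minS; apply.
(* A common boundary path [p] generates both subtrees. *)
- by move=> S S' minS minS' [p [/(minE _ _ minS) -> /(minE _ _ minS') ->]].
(* A minimal subtree meets each level in a single orbit, so its level sets form the path in the
   orbit tree. *)
exists (fun S n => verts S `&` level T r n); split.
- move=> S minS; have [[p bpS] ST] := minimal_subtree_boundary minS.
  rewrite (minE _ _ minS bpS) orbit_subtree_level_set //; last exact: ST.
  by apply: orbit_tree_boundary => //; apply: ST.
- move=> S S' /set_mem minS /set_mem minS'.
  have [[p bpS] /(_ _ bpS) bp] := minimal_subtree_boundary minS.
  have [[q bqS'] /(_ _ bqS') bq] := minimal_subtree_boundary minS'.
  rewrite (minE _ _ minS bpS) (minE _ _ minS' bqS') !orbit_subtree_level_set //.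
  (* Equal level sets put [q n] in the orbit of [p n], so both paths generate the same subtree. *)
  move=> pqE; apply/esym/(orbit_subtree_eq treeT actT bp) => n.
  have /= -> := congr1 (fun O => O n) pqE.
  exact: (orbit_refl actT (boundary_verts treeT n bq)).
- move=> O /(orbit_tree_boundary_lift treeT actT)[p bp Op].
  exists (orbit_subtree T act p); first exact: minP.
  by rewrite orbit_subtree_level_set //; apply/funext => n; rewrite Op.
Qed.
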